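(* Let $n \ge 1$ and let $T_1=([n], E_1)$ and $T_2=([n], E_2)$ be two tournaments on the same vertex set $[n]$. Then there is a vertex $\nu \in [n]$ such that $\nu \Rightarrow j$ for every $j \in [n]$; that is, for every $j\in[n]$ at least one of the following holds: $\nu = j$, or $(\nu,j)\in E_1$, or $(\nu,j)\in E_2$, or there exists $k\in[n]$ with $(\nu,k)\in E_1$ and $(k,j)\in E_2$.
   Context: $[n]=\{1,\dots,n\}$. A tournament $T=([n],E)$ is a directed graph without loops on vertex set $[n]$ such that for every two distinct vertices $i,j$ exactly one of $(i,j)$, $(j,i)$ belongs to $E$. The tournaments $T_1$ and $T_2$ are arbitrary and need not be related. For $i,j\in[n]$, the relation $i\Rightarrow j$ (with respect to the ordered pair $(T_1,T_2)$) means: $i=j$, or $(i,j)\in E_1$, or $(i,j)\in E_2$, or there exists $k$ such that $(i,k)\in E_1$ and $(k,j)\in E_2$. *)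

(* Defs.v *)
From mathcomp Require Import all_boot.
Set Implicit Arguments.
Unset Strict Implicit.
Unset Printing Implicit Defensive.

(* The vertex set [n] = {1, ..., n} is represented by 'I_n = {0, ..., n-1}, and
   an edge set E by its boolean relation: E i j stands for (i, j) \in E.
   The connective (+) is exclusive or. *)
Definition tournament (n : nat) (E : rel 'I_n) : Prop :=
  irreflexive E /\ forall i j : 'I_n, i != j -> E i j (+) E j i.

(* The relation i => j is taken with respect to the ordered pair (E1, E2): in
   a path of length two, the first edge is in E1 and the second one in E2. *)
Definition arrow (n : nat) (E1 E2 : rel 'I_n) (i j : 'I_n) : Prop :=
  [\/ i = j, E1 i j, E2 i j | exists k : 'I_n, E1 i k /\ E2 k j].

(* Main.v *)
(* If no vertex works, every v has some f v whose E2-out-neighbourhood contains v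
   and the E1-out-neighbourhood of v.  On a nonempty set S permuted by f, summing
   1 + d1(v) <= d2(f v) over S (out-degrees taken inside S) contradicts the fact
   that the out-degrees sum to 'C(#|S|, 2) in both tournaments. *)
Require Import Defs.
From mathcomp Require Import all_boot.

(** Adding the sum to its transpose counts each ordered pair of distinct vertices once. The
    right-hand side does not mention [E], so two tournaments have equally many edges inside [S]. *)
Lemma tournament_sum_double (n : nat) (E : rel 'I_n) (S : {set 'I_n}) :
  tournament E ->
  (\sum_(i in S) \sum_(j in S) E i j).*2 = \sum_(i in S) \sum_(j in S) (i != j).
Proof.
case=> irrE totE; rewrite -addnn {2}exchange_big -big_split /=.
apply: eq_bigr => i _; rewrite -big_split /=; apply: eq_bigr => j _.
case: (eqVneq i j) => [->|/totE]; first by rewrite irrE.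
by case: (E i j); case: (E j i).
Qed.

(** Take [S] minimal among nonempty sets mapped into themselves: [f @: S] is another one, so it
    equals [S]. *)
Lemma exists_imset_fixed (T : finType) (x : T) (f : T -> T) :
  exists2 S : {set T}, S != set0 & f @: S = S.
Proof.
pose P (A : {set T}) := (A != set0) && (f @: A \subset A).
have PT : P setT by rewrite /P subsetT andbT; apply/set0Pn; exists x.
have [S /minsetP[/andP[S0 fS] minS] _] := minset_exists PT.
exists S => //; apply: minS => //; rewrite /P imsetS // andbT.
by case/set0Pn: S0 => y yS; apply/set0Pn; exists (f y); apply: imset_f.
Qed.

Theorem theorem1 (n : nat) (hn : 1 <= n) (E1 E2 : rel 'I_n)
    (hT1 : tournament E1) (hT2 : tournament E2) :
  exists v : 'I_n, forall j : 'I_n, arrow E1 E2 v j.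
Proof.
pose a v j := [|| v == j, E1 v j, E2 v j | [exists k, E1 v k && E2 k j]].
have aP v j : a v j -> arrow E1 E2 v j.
  case/or4P => [/eqP|||/existsP[k /andP[]]]; first exact: Or41.
  - exact: Or42.
  - exact: Or43.
  - by move=> *; apply: Or44; exists k.
have [/existsP[v /forallP av]|noking] := boolP [exists v, [forall j, a v j]].
  by exists v => j; apply: aP.
have /fin_all_exists[f fP] v : exists j, ~~ a v j.
  by move: noking; rewrite negb_exists => /forallP/(_ v); rewrite negb_forall => /existsP.
(* For [k = v] or [E1 v k], an edge of [E2] from [k] to [f v] would give [a v (f v)], so that edge
   is reversed. *)
have f_dom v k : (v == k) + E1 v k <= E2 (f v) k.
  have := fP v; rewrite !negb_or => /and4P[v_fv /negbTE E1vf /negbTE E2vf].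
  move=> /existsPn/(_ k); have [<-|v_k] := eqVneq v k.
    by have := hT2.2 _ _ v_fv; rewrite hT1.1 E2vf /= => ->.
  case E1vk: (E1 v k) => //= nE2kf.
  have k_fv : k != f v by apply: contraTneq E1vk => ->; rewrite E1vf.
  by have := hT2.2 _ _ k_fv; rewrite (negbTE nE2kf) /= => ->.
have [S S0 fS] := exists_imset_fixed _ (Ordinal hn) f.
have f_inj : {in S &, injective f} by apply/imset_injP; rewrite fS.
have eq_sum : \sum_(i in S) \sum_(j in S) E1 i j
            = \sum_(i in S) \sum_(j in S) E2 i j.
  by apply: double_inj; rewrite !tournament_sum_double.
have: \sum_(i in S) (1 + \sum_(j in S) E1 i j)
      <= \sum_(i in S) \sum_(j in S) E2 i j.
  (* Only the outer right-hand sum is reindexed along [f]; the inner one still ranges over [S], so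
     [f_dom] applies termwise. *)
  rewrite -{3}fS big_imset //=; apply: leq_sum => i iS.
  have <- : \sum_(j in S) (i == j) = 1.
    rewrite (bigD1 i) //= eqxx big1 // => j /andP[_].
    by rewrite eq_sym => /negbTE->.
  by rewrite -big_split; apply: leq_sum.
by rewrite big_split /= sum1_card eq_sum leqNgt -[ltnLHS]add0n ltn_add2r card_gt0 S0.
Qed.
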